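(* Let $G$ be a connected claw-free graph. Then $G$ has an IPD if and only if $G$ has at least one block which is not a complete graph of odd order.
   Context: All graphs are finite and simple. The order of a path is its number of vertices. A path $P$ in $G$ is induced if the subgraph of $G$ induced on $V(P)$ is exactly $P$. A graph $G$ has an IPD (induced path decomposition) if $V(G)$ can be partitioned into sets $V_1,\dots,V_t$ such that each $G[V_i]$ is a path of order at least $2$ (i.e., $G$ is covered by vertex-disjoint induced paths, each with at least two vertices). A graph is claw-free if it contains no induced subgraph isomorphic to $K_{1,3}$. A block is a maximal $2$-connected subgraph (maximal connected subgraph without a cut vertex of its own); in particular a block may be $K_1$ or $K_2$. *)

(* Defs.v *)
(* A simple graph on a finite vertex type T is a symmetric,
   irreflexive relation e : rel T. *)
From mathcomp Require Import all_boot.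
Set Implicit Arguments. Unset Strict Implicit. Unset Printing Implicit Defensive.

Section Graphs.
Variable T : finType.
Variable e : rel T.

Definition induced_rel (S : {set T}) : rel T :=
  [rel x y | [&& e x y, x \in S & y \in S]].

(* G[S] is connected (the empty set counts as connected here) *)
Definition connected_in (S : {set T}) : Prop :=
  forall x y, x \in S -> y \in S -> connect (induced_rel S) x y.

Definition connected_graph : Prop :=
  0 < #|T| /\ connected_in [set: T].

Definition claw_free : Prop :=
  forall c a b d : T, e c a -> e c b -> e c d ->
    a != b -> a != d -> b != d -> [|| e a b, e a d | e b d].

Definition induced_path_set (P : {set T}) : Prop :=
  exists s : seq T,
    [/\ uniq s, 2 <= size s, (forall x, (x \in P) = (x \in s)) &
        forall (x0 : T) (i j : nat), i < size s -> j < size s ->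
          e (nth x0 s i) (nth x0 s j) = (i.+1 == j) || (j.+1 == i)].

Definition has_IPD : Prop :=
  exists Q : {set {set T}},
    partition Q [set: T] /\ forall P, P \in Q -> induced_path_set P.

Definition nonseparable_set (S : {set T}) : Prop :=
  [/\ S != set0, connected_in S & forall v, v \in S -> connected_in (S :\ v)].

(* a block: maximal nonseparable (connected, cut-vertex-free) subgraph;
   maximal subgraphs of this kind are induced, so we identify them with vertex sets *)
Definition is_block (S : {set T}) : Prop :=
  nonseparable_set S /\
  forall S' : {set T}, S \subset S' -> nonseparable_set S' -> S' = S.

Definition complete_on (S : {set T}) : Prop :=
  forall x y, x \in S -> y \in S -> x != y -> e x y.

End Graphs.

(* Main.v *)
Require Import Defs.
From mathcomp Require Import all_boot.
From mathcomp Require Import zify.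
From Stdlib Require Import Classical.

Set Implicit Arguments. Unset Strict Implicit. Unset Printing Implicit Defensive.

(** If all blocks are odd cliques, let D be a component of G - c.  By induction
on |D|, no part of an induced path decomposition contains c and a neighbour x
of c in D: the block B consisting of c and its neighbours in D would otherwise
meet every part in 0 or 2 vertices, since no part can use an edge leaving B
downwards and an induced path has no triangle; but |B| is odd.

Conversely, removing the first two vertices of a longest path keeps a claw-free
graph connected, so G has a perfect matching, or a matching m missing exactly
one vertex v.  In the second case suppose there is no decomposition.  For every
neighbour w of v, the path v, w, m w must not be induced, so m w is also a
neighbour of v, and replacing {w, m w} by {v, m w} moves the missing vertex to
w.  Hence every vertex can be the missing one.  Sliding the missing vertex along
walks in G - b shows that neighbours of b connected in G - b are adjacent, so
the blocks are cliques; and a matching missing a vertex b of a block S pairs up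
the rest of S. *)

(** * Invariants along walks, and partitions given by class maps *)

(** The invariant is [Prop]-valued because later ones quantify existentially over matchings. *)
Lemma connect_closed (T : finType) (r : rel T) (P : T -> Prop) x y :
  (forall z w, P z -> r z w -> P w) -> connect r x y -> P x -> P y.
Proof.
move=> cl /connectP [p pth ->] {y}.
elim: p x pth => //= z p IH x /andP [xz pth] Px.
exact: IH pth (cl _ _ Px xz).
Qed.

Lemma partition_classes (T : finType) (A : {set T}) (F : T -> {set T}) :
  (forall x, x \in A -> x \in F x) ->
  (forall x y, x \in A -> y \in F x -> y \in A /\ F y = F x) ->
  partition (F @: A) A.
Proof.
move=> Fx FE; apply/and3P; split.
- apply/eqP/setP=> x; apply/bigcupP/idP => [[_ /imsetP [y yA ->] xF]|xA].
    by case: (FE y x yA xF).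
  by exists (F x); [apply: imset_f | apply: Fx].
- apply/trivIsetP => _ _ /imsetP [x xA ->] /imsetP [y yA ->] /eqP ne.
  apply/pred0P => z /=; apply/negP => /andP [zx zy]; apply: ne.
  by rewrite -(FE x z xA zx).2 (FE y z yA zy).2.
- by apply/imsetP => [[x xA E]]; have := Fx x xA; rewrite -E inE.
Qed.

Lemma even_card_pair_classes (T : finType) (A : {set T}) (F : T -> {set T}) :
  (forall x, x \in A -> x \in F x) ->
  (forall x y, x \in A -> y \in F x -> y \in A /\ F y = F x) ->
  (forall x, x \in A -> #|F x| = 2) -> ~~ odd #|A|.
Proof.
move=> Fx FE F2; have part := partition_classes Fx FE.
rewrite (card_uniform_partition _ part (n := 2)) ?oddM ?andbF //.
by move=> _ /imsetP [x xA ->]; apply: F2.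
Qed.

(** * Induced subgraphs and induced paths *)

Section Graph.
Variables (T : finType) (e : rel T).
Hypotheses (e_sym : symmetric e) (e_irr : irreflexive e).

Lemma induced_relE S x y : induced_rel e S x y = [&& e x y, x \in S & y \in S].
Proof. by []. Qed.

Lemma induced_rel_sym S : symmetric (induced_rel e S).
Proof. by move=> x y; rewrite !induced_relE e_sym [(x \in S) && _]andbC. Qed.

Lemma connect_induced_sym S : connect_sym (induced_rel e S).
Proof. exact/sym_connect_sym/induced_rel_sym. Qed.

Lemma edge_neq x y : e x y -> x != y.
Proof. by apply: contraTneq => ->; rewrite e_irr. Qed.

Lemma connect_induced_mem S x y :
  connect (induced_rel e S) x y -> x \in S -> y \in S.
Proof. by apply: (connect_closed (P := [in S])) => z w _ /and3P []. Qed.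

Lemma connect_inducedW (A B : {set T}) x y :
  A \subset B -> connect (induced_rel e A) x y -> connect (induced_rel e B) x y.
Proof.
move=> sAB; apply: connect_sub => z w /and3P [zw zA wA].
by apply: connect1; rewrite induced_relE zw !(subsetP sAB).
Qed.

Lemma has_IPD_classes (F : T -> {set T}) :
  (forall x, x \in F x) -> (forall x y, y \in F x -> F y = F x) ->
  (forall x, induced_path_set e (F x)) -> has_IPD e.
Proof.
move=> Fx FE FP; exists (F @: [set: T]); split; last by move=> _ /imsetP [x _ ->].
by apply: partition_classes => // x y _ /FE.
Qed.

Lemma induced_path_set2 x y : e x y -> induced_path_set e [set x; y].
Proof.
move=> xy; exists [:: x; y]; split=> //=.
- by rewrite inE edge_neq.
- by move=> z; rewrite !inE.
- by move=> x0 [|[|i]] [|[|j]] //= _ _; rewrite ?e_irr // e_sym.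
Qed.

Lemma induced_path_set3 x y z :
  e x y -> e y z -> x != z -> ~~ e x z -> induced_path_set e [set x; y; z].
Proof.
move=> xy yz nxz /negbTE nexz; exists [:: x; y; z]; split=> //=.
- by rewrite !inE negb_or nxz !edge_neq.
- by move=> w; rewrite !inE orbA.
- by move=> x0 [|[|[|i]]] [|[|[|j]]] //= _ _; rewrite ?e_irr // ?nexz // e_sym ?nexz.
Qed.

Lemma induced_path_set_nbr P y :
  induced_path_set e P -> y \in P -> exists2 z, z \in P & e y z.
Proof.
case=> s [us s2 Ps es] yP; have := yP; rewrite Ps => ys.
have ix : index y s < size s by rewrite index_mem.
have [lt|ge] := ltnP (index y s).+1 (size s).
  exists (nth y s (index y s).+1); first by rewrite Ps mem_nth.
  by rewrite -{1}(nth_index y ys) es // eqxx.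
have i0 : 0 < index y s by lia.
exists (nth y s (index y s).-1); first by rewrite Ps mem_nth // (leq_ltn_trans (leq_pred _)).
rewrite -{1}(nth_index y ys) es //; first by rewrite prednK ?eqxx ?orbT.
exact: leq_ltn_trans (leq_pred _) ix.
Qed.

(** Adjacent vertices occupy positions of opposite parity on an induced path. *)
Lemma induced_path_set_triangle P x y z :
  induced_path_set e P -> x \in P -> y \in P -> z \in P ->
  e x y -> e y z -> ~~ e x z.
Proof.
case=> s [us s2 Ps es]; rewrite !Ps => xs ys zs.
rewrite -(nth_index x xs) -(nth_index x ys) -(nth_index x zs).
rewrite !es ?index_mem //; lia.
Qed.

(** * Nonseparable sets and blocks *)

Lemma complete_nonseparable S :
  S != set0 -> complete_on e S -> nonseparable_set e S.
Proof.
have conn A : complete_on e A -> connected_in e A.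
  move=> cA x y xA yA; have [->|ne] := eqVneq x y; first exact: connect0.
  by apply: connect1; rewrite induced_relE cA ?xA.
move=> S0 cS; split=> // [|v vS]; apply: conn => //.
by move=> x y; rewrite !inE => /andP [_ xS] /andP [_ yS]; apply: cS.
Qed.

Lemma path_connected x p : path e x p -> connected_in e [set z in x :: p].
Proof.
move=> pth; have base z : z \in x :: p ->
    connect (induced_rel e [set z in x :: p]) x z.
  elim: p x pth => [|y p IH] x /=; first by rewrite inE => _ /eqP ->.
  case/andP=> xy pth; rewrite inE => /predU1P [->|zp]; first exact: connect0.
  apply: (connect_trans (connect1 (y := y) _)).
    by rewrite induced_relE xy !inE !eqxx !orbT.
  apply: connect_inducedW (IH y pth zp).
  by apply/subsetP => w; rewrite !inE => ->; rewrite orbT.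
move=> z w; rewrite !inE => /base xz /base; apply: connect_trans.
by rewrite connect_induced_sym.
Qed.

(** Rotate the cycle so that the deleted vertex comes first; what follows it is a path, possibly
    empty. *)
Lemma ucycle_nonseparable c : c != [::] -> ucycle e c ->
  nonseparable_set e [set z in c].
Proof.
move=> c0 /andP [cyc uc].
have rotE v : v \in c -> exists s, [/\ c =i v :: s, v \notin s & path e v s /\
    (s = [::] \/ exists y s', s = y :: s' /\ path e y s')].
  move=> vc; have [i s E] := rot_to vc; exists s; split.
  - by move=> z; rewrite -E mem_rot.
  - by move: uc; rewrite -(rot_uniq i) E /= => /andP [].
  - move: cyc; rewrite -(rot_cycle i) E /= rcons_path => /andP [pth _]; split=> //.
    by case: s pth {E} => [|y s'] /=; [left | right; exists y, s'; case/andP: pth].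
split.
- by case: c c0 {cyc uc rotE} => // x c _; apply/set0Pn; exists x; rewrite !inE eqxx.
- case: c c0 cyc {uc rotE} => // x c _ /=; rewrite rcons_path => /andP [pth _].
  exact: path_connected.
- move=> v; rewrite inE => vc; have [s [cE vs [_ H]]] := rotE v vc.
  have -> : [set z in c] :\ v = [set z in s].
    apply/setP => z; rewrite !inE cE inE.
    by have [->|] := eqVneq z v; rewrite //= (negbTE vs).
  case: H => [->|[y [s' [-> pth]]]]; last exact: path_connected.
  by move=> x y; rewrite inE.
Qed.

Lemma nonseparable_sub_block S :
  nonseparable_set e S -> exists2 B : {set T}, is_block e B & S \subset B.
Proof.
elim: {S}_.+1 {-2}S (ltnSn (#|T| - #|S|)) => // n IH S ltn nsS.
have [|nb] := classic (is_block e S); first by exists S.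
have [[S' [sS [nsS' ne]]]|no] :=
  classic (exists S' : {set T}, S \subset S' /\ nonseparable_set e S' /\ S' <> S).
  have lt : #|S| < #|S'|.
    by apply/proper_card; rewrite properEneq sS andbT; apply/eqP => E; apply: ne.
  have le : #|S'| <= #|T| := max_card _.
  have [|B bB sB] := IH S' _ nsS'; first by lia.
  by exists B => //; apply: subset_trans sB.
case: nb; split=> // S' sS nsS'; apply: NNPP => ne; apply: no.
by exists S'.
Qed.

(** A block-free way to say that every block is complete; the next two lemmas give the equivalence.
    Both directions of the theorem work with this form. *)
Definition nbrs_linked_adjacent := forall b x y, e b x -> e b y -> x != y ->
  connect (induced_rel e [set~ b]) x y -> e x y.

(** A walk in S starting at x never leaves the closed neighbourhood of x: if w follows a neighbour z
    of x, then x and w are neighbours of z linked in S minus z, hence equal or adjacent. *)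
Lemma nonseparable_complete S :
  nbrs_linked_adjacent -> nonseparable_set e S -> complete_on e S.
Proof.
move=> Q [_ cS nS] x y xS yS ne.
suff [E|//] : y = x \/ e x y by rewrite E eqxx in ne.
apply: (connect_closed (P := fun z => z = x \/ e x z)) (cS x y xS yS) _; last by left.
move=> z w Pz /and3P [zw zS wS]; case: Pz => [<-|xz]; first by right.
have [->|nwx] := eqVneq w x; [by left | right].
apply: (Q z); rewrite ?(e_sym z) // 1?e_sym 1?eq_sym //.
have xz' := edge_neq xz; have zw' := edge_neq zw.
apply: connect_inducedW (nS z zS x w _ _); rewrite ?inE ?xz' ?xS ?wS ?(eq_sym w) ?zw' //.
by apply/subsetP => u; rewrite !inE => /andP [].
Qed.

(** A simple path from x to y avoiding b closes up through b to a cycle, and a cycle lies inside one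
    block. *)
Lemma complete_blocks_linked :
  (forall B, is_block e B -> complete_on e B) -> nbrs_linked_adjacent.
Proof.
move=> cB b x y bx b_y ne /connectP [p0 pth0 Ey].
case/shortenP: pth0 Ey => p pth up _ Ey.
have bp : b \notin x :: p.
  have pb : path (induced_rel e [set~ b]) x p -> b \notin p.
    elim: p {pth up Ey} x {bx ne} => //= z p IH x /andP [/and3P [_ _ zb] pth].
    by move: zb; rewrite !inE negb_or eq_sym => ->; apply: IH pth.
  by rewrite inE negb_or edge_neq ?pb.
have pe : path e x p by apply: sub_path pth => z w /and3P [].
have ns : nonseparable_set e [set z in [:: b, x & p]].
  apply: ucycle_nonseparable => //; apply/andP; split.
    by rewrite /= bx rcons_path pe -Ey e_sym.
  by rewrite [uniq _]/= bp.
have [B bB sB] := nonseparable_sub_block ns.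
apply: (cB B bB) => //; apply: (subsetP sB); rewrite !inE ?eqxx ?orbT //.
by rewrite Ey; have := mem_last x p; rewrite inE => ->; rewrite orbT.
Qed.

(** * Necessity: no decomposition if all blocks are odd cliques *)

Lemma IPD_block_not_odd_complete :
  0 < #|T| -> has_IPD e -> exists S, is_block e S /\ ~ (complete_on e S /\ odd #|S|).
Proof.
move=> T0 [Q [partQ pathQ]]; apply: NNPP => nB.
have blk S : is_block e S -> complete_on e S /\ odd #|S|.
  by move=> bS; apply: NNPP => nS; apply: nB; exists S.
have nla : nbrs_linked_adjacent by apply: complete_blocks_linked => B /blk [].
pose P y := pblock Q y.
have covQ : cover Q = [set: T] by apply: cover_partition.
have trQ : trivIset Q by case/and3P: partQ.
have PQ y : induced_path_set e (P y) by apply/pathQ/pblock_mem; rewrite covQ inE.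
have Pid y : y \in P y by rewrite mem_pblock covQ inE.
have Peq y z : z \in P y -> P z = P y by move=> zP; apply: same_pblock.
(* For x different from c this is the component of x in G - c. *)
pose D c x := [set z | connect (induced_rel e [set~ c]) x z].
have main n c x : e c x -> #|D c x| < n -> c \notin P x.
  elim: n c x => // n IH c x cx ltn; apply/negP => cPx.
  have cnx := edge_neq cx.
  have xD : x \in D c x by rewrite inE connect0.
  have Dc z : z \in D c x -> z != c.
    by rewrite inE => /connect_induced_mem; rewrite !inE eq_sym; apply.
  pose B := c |: [set v in D c x | e c v].
  have BP v : v \in B -> v = c \/ v \in D c x /\ e c v.
    by rewrite !inE => /predU1P [->|/andP []]; [left | right].
  have Bc : c \in B by rewrite !inE eqxx.
  have Bx : x \in B by rewrite in_setU1 inE xD cx orbT.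
  have cB : complete_on e B.
    move=> u v /BP [->|[uD cu]] /BP [->|[vD cv]] ne //.
    - by rewrite eqxx in ne.
    - by rewrite e_sym.
    - apply: (nla c) => //; apply: connect_trans (_ : connect _ x v).
        by rewrite connect_induced_sym; rewrite inE in uD.
      by rewrite inE in vD.
  (* A nonseparable set containing B is complete, so each further vertex is adjacent to both c and
     x; it therefore lies in D and already belongs to B. *)
  have bB : is_block e B.
    split; first by apply: complete_nonseparable => //; apply/set0Pn; exists c.
    move=> S sS nsS; apply/eqP; rewrite eqEsubset sS andbT; apply/subsetP => v vS.
    have cS := nonseparable_complete nla nsS.
    have [->//|nvc] := eqVneq v c.
    have S_c := subsetP sS c Bc; have Sx := subsetP sS x Bx.
    rewrite in_setU1 in_set cS // 1?eq_sym // andbT orbC inE.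
    have [->|nxv] := eqVneq x v; first by rewrite connect0.
    by rewrite connect1 // induced_relE cS //= !inE nvc eq_sym cnx.
  have [_ oB] := blk B bB.
  (* For y other than c, a neighbour z in the part of y but outside B would contradict the induction
     hypothesis for the edge from y to z: the component of z in G - y lies in D and misses y. *)
  have Pnbr y : y \in B -> exists z, [/\ z \in P y, z \in B & e y z].
    move=> /BP [->|[yD cy]].
      by exists x; rewrite (Peq _ _ cPx) Pid.
    have [z zP yz] := induced_path_set_nbr (PQ y) (Pid y).
    exists z; split=> //; apply: contraT => nzB.
    have nzc : z != c by apply: contraNneq nzB => ->.
    have zD : z \in D c x.
      move: (yD); rewrite !inE => xy; apply: connect_trans xy (connect1 _).
      by rewrite induced_relE yz !inE Dc.
    have ncz : ~~ e c z by apply: contra nzB => cz; rewrite in_setU1 in_set zD cz orbT.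
    suff /negP[] : y \notin P z by rewrite (Peq _ _ zP).
    apply: IH => //; rewrite -ltnS; apply: leq_trans ltn; rewrite ltnS.
    apply: proper_card; apply/properP; split; last first.
      exists y => //; apply/negP; rewrite inE => /connect_induced_mem.
      by rewrite !inE eqxx (eq_sym z) edge_neq // => /(_ isT).
    apply/subsetP => w; rewrite inE => zw.
    pose R u := connect (induced_rel e [set~ y]) z u /\ u \in D c x.
    suff [] : R w by [].
    apply: (connect_closed (P := R)) zw _; last by split; rewrite ?connect0.
    move=> u v [zu uD] uv; split; first exact: connect_trans zu (connect1 uv).
    (* A walk from z in G - y cannot reach c: z and c would be linked neighbours of y, hence
       adjacent, and z would lie in B. *)
    have [Ev|nvc] := eqVneq v c; last first.
      move: (uD); rewrite !inE => xu; apply: connect_trans xu (connect1 _).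
      by case/and3P: uv => uv _ _; rewrite induced_relE uv !inE Dc.
    case/negP: ncz; rewrite e_sym; apply: (nla y) => //; first by rewrite e_sym.
    by rewrite -Ev; apply: connect_trans zu (connect1 uv).
  suff : ~~ odd #|B| by rewrite oB.
  apply: (even_card_pair_classes (F := fun y => P y :&: B)).
  - by move=> y yB; rewrite inE Pid.
  - by move=> y z _; rewrite inE => /andP [zP zB]; split=> //=; rewrite (Peq _ _ zP).
  - move=> y yB; have [z [zP zB yz]] := Pnbr y yB.
    suff -> : P y :&: B = [set y; z] by rewrite cards2 edge_neq.
    apply/setP => w; rewrite in_setI in_set2.
    apply/andP/orP => [[wP wB]|]; last by case=> /eqP ->.
    have [Ey|ny] := eqVneq w y; [by left | right; apply: contraT => nz].
    have := induced_path_set_triangle (PQ y) wP (Pid y) zP.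
    by rewrite (cB w y) // (cB w z) // yz => /(_ isT isT).
have /card_gt0P [x _] := T0.
have [y yP xy] := induced_path_set_nbr (PQ x) (Pid x).
have /negP[] := main _ x y xy (ltnSn _).
by rewrite (Peq _ _ yP).
Qed.

(** * Longest paths in claw-free graphs *)

Definition good_path (A : {set T}) (s : seq T) :=
  [&& uniq s, all [in A] s & sorted e s].

Lemma longest_good_path A : exists2 s, good_path A s &
  forall s', good_path A s' -> size s' <= size s.
Proof.
pose P n := [exists t : n.-tuple T, good_path A t].
have P0 : exists n, P n by exists 0; apply/existsP; exists [tuple].
have ub n : P n -> n <= #|T|.
  case/existsP=> t /and3P [/card_uniqP + _ _].
  by rewrite size_tuple => <-; apply: max_card.
case: (ex_maxnP P0 ub) => n /existsP [t gt] max.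
exists t => // s' gs'; rewrite size_tuple; apply: max.
by apply/existsP; exists (in_tuple s').
Qed.

(* The first two vertices of a longest path can always be removed. *)
Lemma removable_edge A : claw_free e -> connected_in e A -> 1 < #|A| ->
  exists u v, [/\ u \in A, v \in A, e u v & connected_in e (A :\ u :\ v)].
Proof.
move=> cf cA A1; have [s] := longest_good_path A.
case: s => [|v1 [|v2 q]] gs max.
- have /card_gt0P [x xA] : 0 < #|A| by apply: ltnW.
  by have := max [:: x]; rewrite /good_path /= xA => /(_ isT).
- have v1A : v1 \in A by case/and3P: gs => _ /andP [].
  have /card_gt0P [x] : 0 < #|A :\ v1| by rewrite (cardsD1 v1) v1A in A1.
  rewrite !inE => /andP [nx xA]; case/connectP: (cA v1 x v1A xA) => [[|w p]] /=.
    by move=> _ E; rewrite E eqxx in nx.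
  case/andP=> /and3P [vw _ wA] _ _; have := max [:: w; v1].
  by rewrite /good_path /= wA v1A e_sym vw inE eq_sym edge_neq // => /(_ isT).
case/and3P: gs => us /allP sA /andP [v12 pth].
have v1A : v1 \in A by apply: sA; rewrite mem_head.
have v2A : v2 \in A by apply: sA; rewrite !inE eqxx orbT.
exists v1, v2; split=> //; set A' := A :\ v1 :\ v2.
(* By maximality, the end v1 has no neighbour in A off the path. *)
have ext z : z \in A -> e z v1 -> z \in [:: v1, v2 & q].
  move=> zA zv; apply: contraT => nz.
  have := max [:: z, v1, v2 & q]; rewrite ltnn; apply.
  apply/and3P; split; first by rewrite /= in us *; rewrite nz.
  - by apply/allP => w; rewrite inE => /predU1P [->|/sA].
  - by rewrite /= zv v12.
(* The third vertex v3 of the path serves as base point of A'. If the path has only two vertices, P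
   is empty, and so A' will be shown to be empty. *)
pose P z := exists v3 q', q = v3 :: q' /\ connect (induced_rel e A') v3 z.
have Pq z : z \in q -> P z.
  move=> zq; case Eq: q => [|v3 q']; first by rewrite Eq in zq.
  rewrite Eq in us sA pth zq; case/andP: pth => _ pth.
  exists v3, q'; split=> //.
  have cq : connected_in e [set z in v3 :: q'] by apply: path_connected.
  apply: connect_inducedW (cq v3 z _ _); last 2 first.
  - by rewrite !inE eqxx.
  - by rewrite inE.
  apply/subsetP => w; rewrite !inE => wq.
  have wA : w \in A by apply: sA; rewrite !inE wq !orbT.
  case/and3P: us => n1 n2 _; rewrite wA andbT.
  apply/andP; split; [apply: contraNneq n2 => <- | apply: contraNneq n1 => <-].
    by rewrite inE.
  by rewrite !inE wq !orbT.
have Pmem z : P z -> z \in A'.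
  case=> v3 [q' [Eq]] /connect_induced_mem; apply.
  have : v3 \in A by apply: sA; rewrite Eq !inE eqxx !orbT.
  move: us; rewrite Eq /= !inE !negb_or => /and3P [/and3P [_ n13 _] /andP [n23 _] _].
  by rewrite !(eq_sym v3) n13 n23.
suff PA' w : w \in A' -> P w.
  move=> x y /PA' [v3 [q' [E cx]]] /PA' [v3' [q'' [E' cy]]].
  move: E'; rewrite E => -[E' _]; rewrite -E' in cy.
  by apply: connect_trans cy; rewrite connect_induced_sym.
move=> wA'; have wA : w \in A by move: wA'; rewrite !inE => /and3P [].
suff : w = v1 \/ w = v2 \/ P w.
  by move: wA'; rewrite !inE => /and3P [/eqP ? /eqP ? _] [|[]].
apply: (connect_closed (P := fun z => z = v1 \/ z = v2 \/ P z))
  (cA _ _ v1A wA) _; last by left.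
move=> z u Pz /and3P [zu zA uA].
have [->|n1] := eqVneq u v1; first by left.
have [->|n2] := eqVneq u v2; right; [by left | right].
have uA' : u \in A' by rewrite !inE n1 n2.
case: Pz zu => [->|[->|Pz]] zu; last first.
- have zA' := Pmem z Pz; case: Pz => v3 [q' [Eq cz]]; exists v3, q'; split=> //.
  by apply: connect_trans cz (connect1 _); rewrite induced_relE zu zA'.
- have [/Pq //|nuq] := boolP (u \in q).
  have nus : u \notin [:: v1, v2 & q] by rewrite !inE !negb_or n1 n2.
  have nu1 : ~~ e u v1 by apply: contra nus; apply: ext.
  (* Here u is a neighbour of v2 off the path. If the path stops at v2, then u, v2, v1 is longer. *)
  case Eq: q => [|v3 q']; rewrite Eq in us sA pth max nuq nus.
    suff : false by []; have := max [:: u; v2; v1]; rewrite ltnn; apply.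
    rewrite /good_path /= uA v1A v2A (e_sym u) zu (e_sym v2) v12 !inE.
    by rewrite negb_or n1 n2 eq_sym edge_neq.
  have v3A : v3 \in A by apply: sA; rewrite !inE eqxx !orbT.
  have [v23 pth'] := andP pth.
  exists v3, q'; split=> //; apply: contraT => nc.
  have : v1 \notin [:: v2, v3 & q'] by case/andP: us.
  rewrite !inE !negb_or => /and3P [n12 n13 n1q].
  have n23 : v2 != v3 by apply: edge_neq.
  have v3A' : v3 \in A' by rewrite !inE !(eq_sym v3) n13 n23.
  have nu3 : ~~ e v3 u by apply: contra nc => vu; rewrite connect1 // induced_relE vu v3A'.
  have nv3u : v3 != u by apply: contraNneq nuq => ->; rewrite mem_head.
  (* Since u is adjacent to neither v1 nor v3, claw-freeness at v2 makes v1 and v3 adjacent, and u,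
     v2, v1, v3, ... is a longer path. *)
  have := cf v2 v1 v3 u; rewrite (e_sym v2 v1) v12 v23 zu n13 (eq_sym v1) n1 nv3u.
  rewrite (e_sym v1 u) (negbTE nu1) (negbTE nu3) !orbF => /(_ isT isT isT isT isT isT) v13.
  have := max [:: u, v2, v1, v3 & q']; rewrite ltnn; apply; apply/and3P; split.
  + move: us nus; rewrite /= !inE !negb_or (eq_sym v2 v1).
    by case/and4P => /and3P [-> -> ->] /andP [-> ->] -> -> /and4P [-> -> -> ->].
  + apply/allP => t; rewrite inE => /predU1P [->//|tq]; apply: sA.
    by move: tq; rewrite !inE orbCA.
  + by rewrite /= (e_sym u) zu (e_sym v2) v12 v13.
- by move: (ext u uA); rewrite e_sym zu !inE (negbTE n1) (negbTE n2) => /(_ isT) /Pq.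
Qed.

(** * Perfect and near-perfect matchings *)

(** A perfect matching of G[A] as a partner map. Fixing the vertices outside A makes it an
    involution of all of T, and irreflexivity of [e] then forces it to preserve A. *)
Definition matching (A : {set T}) (m : T -> T) :=
  involutive m /\ forall x, if x \in A then e x (m x) else m x == x.

Lemma matching_edge A m x : matching A m -> x \in A -> e x (m x).
Proof. by case=> _ /(_ x) + xA; rewrite xA. Qed.

Lemma matching_fix A m x : matching A m -> x \notin A -> m x = x.
Proof. by case=> _ /(_ x) + xA; rewrite (negbTE xA) => /eqP. Qed.

Lemma matching_id : matching set0 id.
Proof. by split=> // x; rewrite inE. Qed.

Lemma matching_add A m u v : matching A m -> e u v -> u \notin A -> v \notin A ->
  matching (u |: (v |: A)) (fun x => if x == u then v else if x == v then u else m x).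
Proof.
move=> mA uv nu nv; have ne := edge_neq uv; have [mK _] := mA.
have mx x w : w \notin A -> x != w -> m x != w.
  by move=> nw; apply: contra_neq => E; rewrite -(mK x) E (matching_fix mA).
split=> x; rewrite ?inE.
  have [->|xu] := eqVneq x u; first by rewrite eq_sym (negbTE ne) eqxx.
  have [->|xv] := eqVneq x v; first by rewrite eqxx.
  by rewrite (negbTE (mx _ _ nu xu)) (negbTE (mx _ _ nv xv)) mK.
have [->//|xu] := eqVneq x u.
have [->|xv] /= := eqVneq x v; first by rewrite e_sym.
by case: mA.
Qed.

(** Pairs supplied by [removable_edge] are split off until at most one vertex is left. *)
Lemma claw_free_near_matching A : claw_free e -> connected_in e A ->
  exists m, matching A m \/ exists2 b, b \in A & matching (A :\ b) m.
Proof.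
move=> cf; elim: {A}_.+1 {-2}A (ltnSn #|A|) => // n IH A ltn cA.
case: (ltngtP #|A| 1) => A1.
- by exists id; left; move: A1; rewrite ltnS leqn0 cards_eq0 => /eqP ->; apply: matching_id.
- have [u [v [uA vA uv cA']]] := removable_edge cf cA A1.
  set A' := A :\ u :\ v in cA'; have vu : v != u by rewrite eq_sym edge_neq.
  have EA : A = u |: (v |: A').
    by rewrite /A' setD1K ?inE ?vu // setD1K.
  have nu : u \notin A' by rewrite !inE eqxx andbF.
  have nv : v \notin A' by rewrite !inE eqxx.
  have lt : #|A'| < n.
    have := cardsD1 v (A :\ u); have := cardsD1 u A.
    rewrite uA !inE vu vA -/A'; lia.
  have [m [mA|[b bA mA]]] := IH A' lt cA'.
    by have := matching_add mA uv nu nv; rewrite -EA; eexists; left; eassumption.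
  have ub : u != b by apply: contraNneq nu => ->.
  have vb : v != b by apply: contraNneq nv => ->.
  have := matching_add mA uv; rewrite !inE !eqxx !andbF => /(_ isT isT) mA'.
  eexists; right; exists b; first by rewrite EA !in_setU1 bA !orbT.
  suff -> : A :\ b = u |: (v |: A' :\ b) by eassumption.
  apply/setP => z; rewrite in_setD1 {1}EA !in_setU1 in_setD1.
  have [->|zb] //= := eqVneq z b.
  by rewrite !orbF (eq_sym b) (negbTE ub) eq_sym (negbTE vb).
- have /cards1P [b ->] : #|A| == 1 by rewrite A1.
  by exists id; right; exists b; rewrite ?inE // setDv; apply: matching_id.
Qed.

Lemma perfect_matching_IPD m : matching [set: T] m -> has_IPD e.
Proof.
move=> mT; have [mK _] := mT.
apply: (has_IPD_classes (F := fun x => [set x; m x])).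
- by move=> x; rewrite !inE eqxx.
- by move=> x y; rewrite !inE => /orP [] /eqP -> //; rewrite mK setUC.
- by move=> x; apply: induced_path_set2; apply: matching_edge mT _.
Qed.

(** * Moving the unmatched vertex when there is no decomposition *)

Section NoIPD.
Hypotheses (G_conn : connected_graph e) (no_IPD : ~ has_IPD e).

Definition near (v : T) m := matching [set~ v] m.

Lemma near_fix v m : near v m -> m v = v.
Proof. by move=> nm; apply: (matching_fix nm); rewrite !inE eqxx. Qed.

Lemma near_edge v m x : near v m -> x != v -> e x (m x).
Proof. by move=> nm xv; apply: (matching_edge nm); rewrite !inE. Qed.

Lemma near_neq v m x w : near v m -> x != m w -> m x != w.
Proof. by case=> mK _; apply: contra_neq => <-; rewrite mK. Qed.

(* Otherwise v, w, m w is an induced path and m matches all other vertices. *)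
Lemma near_closed v m w : near v m -> e v w -> e v (m w).
Proof.
move=> nm vw; have wv : w != v by rewrite eq_sym edge_neq.
have [mK _] := nm; have mv := near_fix nm.
apply: contraT => nvw; case: no_IPD; set P := [set v; w; m w].
have mP x : (m x \in P) = (x \in P).
  have half y : y \in P -> m y \in P.
    by rewrite !inE => /orP [/orP [] |] /eqP ->; rewrite ?mv ?mK eqxx ?orbT.
  by apply/idP/idP => [/half|/half //]; rewrite mK.
have pathP : induced_path_set e P.
  apply: induced_path_set3 => //; first exact: near_edge nm wv.
  by rewrite eq_sym (near_neq nm) // mv.
apply: (has_IPD_classes (F := fun x => if x \in P then P else [set x; m x])).
- by move=> x; case: ifP => // _; rewrite !inE eqxx.
- move=> x y; case: (boolP (x \in P)) => [xP yP|xP]; first by rewrite yP.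
  rewrite in_set2 => /orP [] /eqP ->; first by rewrite (negbTE xP).
  by rewrite mP (negbTE xP) mK setUC.
- move=> x; case: ifP => // /negbT xP; apply: induced_path_set2.
  by apply: near_edge nm _; apply: contraNneq xP => ->; rewrite !inE eqxx.
Qed.

Lemma near_step v m w : near v m -> e v w -> near w
  (fun x => if x == w then w else if x == v then m w else if x == m w then v else m x).
Proof.
move=> nm vw; have wv : w != v by rewrite eq_sym edge_neq.
have [mK _] := nm; have mv := near_fix nm; have vmw := near_closed nm vw.
have mwv : m w != v by rewrite eq_sym edge_neq.
have mww : m w != w by rewrite eq_sym edge_neq // (near_edge nm).
split=> x.
  have [->|xw] := eqVneq x w; first by rewrite eqxx.
  have [->|xv] := eqVneq x v; first by rewrite (negbTE mww) (negbTE mwv) eqxx.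
  have [->|xm] := eqVneq x (m w); first by rewrite eq_sym (negbTE wv) eqxx.
  rewrite (negbTE (near_neq nm xm)) (negbTE (near_neq nm _)) ?mv //.
  by rewrite (inj_eq (can_inj mK)) (negbTE xw) mK.
rewrite !inE; have [->|xw] /= := eqVneq x w; first exact: eqxx.
have [->//|xv] := eqVneq x v.
have [->|xm] := eqVneq x (m w); first by rewrite e_sym.
exact: near_edge nm xv.
Qed.

Lemma near_everywhere v m b : near v m -> exists m', near b m'.
Proof.
move=> nm; have [_ cT] := G_conn.
apply: (connect_closed (P := fun z => exists m', near z m')) (cT v b _ _) _ => //.
- move=> z w [m' nm'] /and3P [zw _ _]; eexists; exact: near_step nm' zw.
- by exists m.
Qed.

(* Sliding the unmatched vertex along a walk from x to y in G - b, the partner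
   of b stays within {x, m x}. *)
Lemma near_linked v m0 : near v m0 -> nbrs_linked_adjacent.
Proof.
move=> /near_everywhere nearT b x y bx b_y ne cxy.
have [m nm] := nearT b; have [mK _] := nm.
have xb : x != b by rewrite eq_sym edge_neq.
have bmx := near_closed nm bx; have xmx := near_edge nm xb.
have mxb : m x != b by rewrite eq_sym edge_neq.
have yb : y != b by rewrite eq_sym edge_neq.
have [->//|ymx] := eqVneq y (m x).
(* The first slide, from b to a neighbour t, gives b the former partner of t. *)
have start t : e b t -> exists2 m', near t m' & m' b = m t.
  move=> bt; exists (fun x => if x == t then t else if x == b then m t
    else if x == m t then b else m x); first exact: near_step.
  by rewrite (negbTE (edge_neq bt)) eqxx.
pose R z := z != b /\ exists2 m', near z m' & m' b = x \/ m' b = m x.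
have [_ [m' nm' Em']] : R y.
  apply: (connect_closed (P := R)) cxy _; last first.
    by split=> //; have [m' nm' E] := start x bx; exists m' => //; right.
  move=> z w [zb [m1 nm1 E1]] /and3P [zw _]; rewrite !inE => wb; split=> //.
  (* Sliding onto the partner of b would rematch b with z. But then w is x or m x, so a fresh slide
     of m from b to w works instead. Any other slide leaves the partner of b unchanged. *)
  have [Ew|nw] := eqVneq w (m1 b).
    case: E1 => E1; rewrite Ew E1.
      by have [m' nm' E] := start x bx; exists m' => //; right.
    by have [m' nm' E] := start _ bmx; exists m' => //; left; rewrite E mK.
  eexists; first exact: near_step nm1 zw.
  have mwb := near_neq nm1 nw.
  by rewrite /= !(eq_sym b) (negbTE wb) (negbTE zb) (negbTE mwb).
have ybp := near_closed nm' (_ : e y b); rewrite e_sym in ybp.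
have {ybp} := ybp b_y; case: Em' => ->; first by rewrite e_sym.
(* Now y is adjacent to m x. Sliding m from b to y keeps the pair x, m x, so [near_closed] at y
   yields the edge from y to x. *)
move=> ym; rewrite e_sym.
have := near_closed (near_step nm b_y) ym.
by rewrite eq_sym (negbTE ymx) (negbTE mxb) (inj_eq (can_inj mK)) (negbTE ne) mK.
Qed.

Lemma near_block_odd v m0 S : near v m0 -> is_block e S -> odd #|S|.
Proof.
move=> nm0 [nsS maxS]; have Q := near_linked nm0.
have cS := nonseparable_complete Q nsS.
have [/set0Pn [b bS] _ _] := nsS.
have [m nm] := near_everywhere b nm0; have [mK _] := nm.
have mS x : x \in S :\ b -> m x \in S :\ b.
  rewrite !inE => /andP [xb xS].
  have bx : e b x by rewrite cS // eq_sym.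
  have bmx := near_closed nm bx; have xmx := near_edge nm xb.
  have mxb : m x != b by rewrite eq_sym edge_neq.
  rewrite mxb /=.
  (* Both s and m x are neighbours of b, linked through x in G - b. *)
  have adj s : s \in S -> s != m x -> e s (m x).
    move=> sS ne; have [->//|sb] := eqVneq s b.
    have [->//|sx] := eqVneq s x.
    apply: (Q b) => //; first by rewrite cS // eq_sym.
    apply: (connect_trans (y := x)); apply: connect1; rewrite induced_relE !inE.
      by rewrite cS // sb.
    by rewrite xmx xb.
  (* Adding m x to S keeps it complete, so maximality of the block puts m x in S. *)
  rewrite -(maxS (m x |: S)) ?subsetUr ?setU11 //.
  apply: complete_nonseparable; first by apply/set0Pn; exists b; rewrite !inE bS orbT.
  move=> s t; rewrite !inE => /predU1P [->|sS] /predU1P [->|tS] st.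
  - by rewrite eqxx in st.
  - by rewrite e_sym adj // eq_sym.
  - exact: adj.
  - exact: cS.
rewrite (cardsD1 b) bS /=.
apply: (even_card_pair_classes (F := fun x => [set x; m x])).
- by move=> x _; rewrite !inE eqxx.
- move=> x y xS; rewrite in_set2 => /orP [] /eqP -> //.
  by split; [apply: mS | rewrite mK setUC].
- move=> x; rewrite !inE => /andP [xb _]; rewrite cards2 edge_neq //.
  exact: near_edge nm xb.
Qed.

End NoIPD.
End Graph.

Theorem mainTheorem1 (T : finType) (e : rel T)
  (e_sym : symmetric e) (e_irr : irreflexive e)
  (G_conn : connected_graph e) (G_cf : claw_free e) :
  has_IPD e <->
  exists S : {set T}, is_block e S /\ ~ (complete_on e S /\ odd #|S|).
Proof.
have [T0 cT] := G_conn.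
split; first exact: IPD_block_not_odd_complete.
move=> [S [bS nS]]; apply: NNPP => no_IPD; apply: nS.
have [m [mT|[b _]]] := claw_free_near_matching e_sym e_irr G_cf cT.
  by case: no_IPD; apply: perfect_matching_IPD mT.
rewrite setTD => nm; split; last first.
  exact: (near_block_odd e_sym e_irr G_conn no_IPD nm bS).
apply: nonseparable_complete => //; last by case: bS.
exact: (near_linked e_sym e_irr G_conn no_IPD nm).
Qed.
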